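(* Let $k$ be an algebraically closed field of characteristic $0$, let $N\ge 1$ and $n\geq 1$ be integers, and let $I\subseteq R=k[x_0,\ldots,x_N]$ be the defining ideal of $n$ very general points in $\mathbb{P}_k^N$. Then for all $m\geq 1$ $$\frac{\alpha(I^{(m)})}{m}\geq \frac{\alpha(I)+N-1}{N}.$$
   Context: For a finite set $X$ of distinct points of $\mathbb{P}^N_k$, its defining ideal $I_X\subseteq R=k[x_0,\ldots,x_N]$ is the (radical, homogeneous) ideal generated by all homogeneous polynomials vanishing on $X$. For a homogeneous ideal $I$ of $R$: the initial degree $\alpha(I)$ is the least degree of a nonzero homogeneous polynomial in $I$; the $m$-th symbolic power is $I^{(m)}=\bigcap_{p}(I^mR_p\cap R)$, where $p$ runs over all associated primes of $R/I$ (so for $X=\{p_1,\ldots,p_n\}$ one has $I_X^{(m)}=\bigcap_i I(p_i)^m$, where $I(p_i)$ is the ideal of the point $p_i$). Very general points: let $G(1,n,N+1)\cong \mathrm{Sym}^n(\mathbb{P}_k^N)=(\mathbb{P}^N_k)^n/S_n$ be the Chow variety of $0$-cycles of degree $n$ in $\mathbb{P}_k^N$. A property $\mathcal{P}$ holds for $n$ very general points in $\mathbb{P}_k^N$ if there is a nonempty subset $W\subseteq G(1,n,N+1)$ of the form $W=\bigcap_{i=1}^\infty U_i$, with each $U_i$ a dense Zariski-open subset, such that $\mathcal{P}$ holds for every set $X=\{p_1,\ldots,p_n\}$ of $n$ (distinct) points with $p_1+\cdots+p_n\in W$. *)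

(* Defs.v *)
From HB Require Import structures.
From mathcomp Require Import all_boot all_order all_algebra.
From mathcomp Require Import generic_quotient fraction.
From mathcomp Require Import boolp classical_sets.
From mathcomp Require Import mpoly.

Set Implicit Arguments.
Unset Strict Implicit.
Unset Printing Implicit Defensive.

Import GRing.Theory.

Local Open Scope ring_scope.
Local Open Scope quotient_scope.
Local Open Scope classical_set_scope.

Section Ideals.
Variable R : idomainType.
Implicit Types (I J P : set R).

Definition is_ideal I : Prop :=
  [/\ I 0, forall f g, I f -> I g -> I (f + g) & forall c f, I f -> I (c * f)].

Definition is_prime_ideal P : Prop :=
  [/\ is_ideal P, ~ P 1 & forall f g, P (f * g) -> P f \/ P g].

Definition ideal_span (S : set R) : set R :=
  [set f | exists r (c g : 'I_r -> R),
     (forall i, S (g i)) /\ f = \sum_i c i * g i].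

Definition ideal_exp I (m : nat) : set R :=
  ideal_span [set f | exists g : 'I_m -> R, (forall i, I (g i)) /\ f = \prod_i g i].

(* P is the annihilator in R of the class of some f in R / I. *)
Definition associated_prime I P : Prop :=
  is_prime_ideal P /\ exists f, P = [set g | I (g * f)].

(* R_P, as a subring of the fraction field of the domain R. *)
Definition local_ring P : set {fraction R} :=
  [set x | exists a s, ~ P s /\ x = tofrac a / tofrac s].

(* The extended ideal J R_P. *)
Definition local_ext P J : set {fraction R} :=
  [set x | exists r (u : 'I_r -> {fraction R}) (a : 'I_r -> R),
     (forall i, local_ring P (u i) /\ J (a i)) /\
     x = \sum_i u i * tofrac (a i)].

Definition symbolic_power I (m : nat) : set R :=
  \bigcap_(P in associated_prime I)
    [set f | local_ext P (ideal_exp I m) (tofrac f)].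

End Ideals.

(* The default value 0 is taken only if I contains no nonzero form. *)
Definition initial_degree (k : fieldType) (r : nat) (I : set {mpoly k[r]}) : nat :=
  xget 0%N [set d |
    (exists f : {mpoly k[r]}, [/\ f != 0, f \is d.-homog & I f]) /\
    (forall e (f : {mpoly k[r]}), f != 0 -> f \is e.-homog -> I f -> (d <= e)%N)].

Section ProjectiveSpace.
Variables (k : fieldType) (N : nat).

Definition nonzero_row := {v : 'rV[k]_N.+1 | v != 0}.

(* Equality of the lines spanned by u and v. *)
Definition same_line : rel nonzero_row := fun u v => (val u == val v)%MS.

Fact same_line_equiv : equiv_class_of same_line.
Proof.
split=> [u|u v|v u w]; rewrite /same_line ?submx_refl //.
- by rewrite andbC.
- by move=> /eqmxP uv /eqmxP vw; apply/eqmxP; apply: eqmx_trans uv vw.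
Qed.

Canonical same_line_equivRel := EquivRelPack same_line_equiv.

Definition proj_space := {eq_quot same_line_equivRel}.

(* Homogeneous coordinates, for a chosen representative: only conditions
   that are invariant under rescaling may be stated with them. *)
Definition coords (p : proj_space) : 'rV[k]_N.+1 := val (repr p).

Definition vanishing_ideal (X : set proj_space) : set {mpoly k[N.+1]} :=
  ideal_span [set f | (exists d, f \is d.-homog) /\
                      forall p, X p -> f.@[fun j => coords p 0 j] = 0].

End ProjectiveSpace.

Section Cycles.
Variables (k : fieldType) (N n : nat).
Local Notation PN := (proj_space k N).

(* The variable of index mxvec_index i j is the j-th homogeneous coordinate
   of the i-th point. *)
Definition multi_coords (s : n.-tuple PN) : 'I_(n * N.+1) -> k :=
  fun l => mxvec (\matrix_(i < n, j < N.+1) coords (tnth s i) 0 j) 0 l.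

Definition multihomogeneous (f : {mpoly k[n * N.+1]}) : Prop :=
  exists d : 'I_n -> nat, forall m, m \in msupp f ->
    forall i, (\sum_(j < N.+1) m (mxvec_index i j))%N = d i.

Definition closed_product (Z : set (n.-tuple PN)) : Prop :=
  exists S : set {mpoly k[n * N.+1]},
    (forall f, S f -> multihomogeneous f) /\
    Z = [set s | forall f, S f -> f.@[multi_coords s] = 0].

Definition same_cycle : rel (n.-tuple PN) := fun s t => perm_eq s t.

Fact same_cycle_equiv : equiv_class_of same_cycle.
Proof.
split=> [s|s t|t s u]; rewrite /same_cycle //.
- by rewrite perm_sym.
- exact: perm_trans.
Qed.

Canonical same_cycle_equivRel := EquivRelPack same_cycle_equiv.

(* The k-points of (P^N)^n / S_n: effective 0-cycles of degree n. *)
Definition chow0 := {eq_quot same_cycle_equivRel}.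

(* p_1 + ... + p_n *)
Definition cycle_of (s : n.-tuple PN) : chow0 := \pi_chow0 s.

(* Quotient topology of the Zariski topology on (P^N)^n, which is the Zariski
   topology of the quotient variety because S_n is finite. *)
Definition zariski_open (U : set chow0) : Prop :=
  closed_product (~` (cycle_of @^-1` U)).

Definition zariski_dense (U : set chow0) : Prop :=
  forall V, zariski_open V -> V !=set0 -> U `&` V !=set0.

Definition for_very_general_points (Q : set PN -> Prop) : Prop :=
  exists U : nat -> set chow0,
    [/\ forall i, zariski_open (U i) /\ zariski_dense (U i),
        \bigcap_i U i !=set0 &
        forall s : n.-tuple PN, uniq s -> (\bigcap_i U i) (cycle_of s) ->
          Q [set` s]].

End Cycles.

(* Main.v *)
(* Let d be least with n < C(d+N, N), so alpha(I) <= d by counting monomials, and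
   n >= C(r, N) with r = d+N-1. For each m, the n-tuples of points admitting no form of
   degree e with N e < r m and multiplicity at least m at each of them form an open set;
   all these open sets contain any n-tuple that includes a star configuration, the
   C(r, N) points where N of r general hyperplanes of P^N meet. The bound N e >= r m for
   a star configuration is by induction on N: let a_t be the order of f along the t-th
   hyperplane; restricting f / l_t^(a_t) to that hyperplane, which carries a star
   configuration of r-1 hyperplanes of P^(N-1), gives
   (N-1)(e - a_t) >= (r-1)(m - a_t), and summing over t with sum_t a_t <= e concludes. *)
Require Import Defs.
From HB Require Import structures.
From mathcomp Require Import all_boot all_order all_algebra.
From mathcomp Require Import classical_sets mpoly.
From mathcomp Require Import perm generic_quotient fraction boolp.
From mathcomp Require Import zify ring.

Set Implicit Arguments.
Unset Strict Implicit.
Unset Printing Implicit Defensive.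

Import GRing.Theory.

Local Open Scope ring_scope.

(** * Substitution into polynomials and homogeneous components *)

Lemma rmorph_mmap (n : nat) (R : nzRingType) (A B : comNzRingType)
    (phi : {rmorphism A -> B}) (iota : R -> A) (h : 'I_n -> A) (f : {mpoly R[n]}) :
  phi (mmap iota h f) = mmap (phi \o iota) (phi \o h) f.
Proof.
rewrite /mmap rmorph_sum; apply: eq_bigr => m _.
rewrite rmorphM rmorph_prod; congr (_ * _).
by apply: eq_bigr => i _; rewrite rmorphXn.
Qed.

Lemma mmap_eqr (n : nat) (R S : nzRingType) (i1 i2 : R -> S) (h1 h2 : 'I_n -> S)
    (f : {mpoly R[n]}) : i1 =1 i2 -> h1 =1 h2 -> mmap i1 h1 f = mmap i2 h2 f.
Proof.
move=> eqi eqh; apply: eq_bigr => m _; rewrite eqi; congr (_ * _).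
exact: mmap1_eq.
Qed.

Lemma mmap_scale (n : nat) (R : nzRingType) (A : comNzRingType) (iota : R -> A)
    (h : 'I_n -> A) (c : A) (e : nat) (f : {mpoly R[n]}) :
  f \is e.-homog -> mmap iota (fun i => c * h i) f = c ^+ e * mmap iota h f.
Proof.
move=> /dhomogP fe; rewrite /mmap mulr_sumr big_seq [RHS]big_seq.
apply: eq_bigr => m /fe <-; rewrite mulrCA; congr (_ * _).
rewrite /mmap1 /= mdegE -prodrXr -big_split /=.
by apply: eq_bigr => i _; rewrite exprMn.
Qed.

(** Divisibility of differences by [l] is stable under sums and products. This is how a substitution
    that moves the variables only modulo a linear form yields divisibility by that form. *)
Lemma mmap_congr (n : nat) (R : nzRingType) (A : comNzRingType) (iota : R -> A)
    (h h' : 'I_n -> A) (l : A) (f : {mpoly R[n]}) :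
  (forall i, exists c, h i - h' i = l * c) ->
  exists c, mmap iota h f - mmap iota h' f = l * c.
Proof.
move=> hh; pose cg a b := exists c, a - b = l * c; rewrite -/(cg _ _).
have refl a : cg a a by exists 0; rewrite mulr0 subrr.
have mul a b a' b' : cg a b -> cg a' b' -> cg (a * a') (b * b').
  move=> [c E] [c' E']; exists (c * a' + b * c').
  by rewrite mulrDr mulrA -E mulrCA -E'; ring.
apply: (big_ind2 cg) => //.
  move=> a b a' b' [c E] [c' E']; exists (c + c').
  by rewrite mulrDr -E -E'; ring.
move=> m _; apply: (mul) => //; apply: (big_ind2 cg) => // i _.
by elim: (m i) => [|j ih]; rewrite ?expr0 // !exprS; apply: (mul).
Qed.

Lemma dhomog_comp (n p : nat) (R : comNzRingType) (L : n.-tuple {mpoly R[p]}) e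
    (f : {mpoly R[n]}) :
  (forall i, tnth L i \is 1.-homog) -> f \is e.-homog -> f \mPo L \is e.-homog.
Proof.
move=> L1 /dhomogP fe; rewrite comp_mpolyE big_seq; apply: rpred_sum => m /fe <-.
apply: rpredZ; rewrite /= mdegE.
elim/big_rec2: _ => [|i d q _ qd]; first exact: dhomog1.
by apply: dhomogM => //; have := dhomogMn (m i) (L1 i); rewrite mul1n.
Qed.

Lemma dhomog_sum_pihomog (n : nat) (R : nzRingType) (f : {mpoly R[n]}) :
  f = \sum_(d < msize f) pihomog mdeg d f.
Proof. by rewrite -pihomog_partitionE. Qed.

(** In degree e only the component of [g] of degree e - 1 contributes to the product, so that
    component can replace [g]. *)
Lemma dhomog_factor (n : nat) (R : comNzRingType) e (l g : {mpoly R[n]}) :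
  l \is 1.-homog -> l * g \is e.-homog -> l * g != 0 ->
  exists g', [/\ l * g = l * g', g' \is e.-1.-homog & (0 < e)%N].
Proof.
move=> l1 lge lg0; have E : l * g = \sum_(d < msize g | d.+1 == e) l * pihomog mdeg d g.
  rewrite -[LHS](pihomog_dE lge) {1}(dhomog_sum_pihomog g) mulr_sumr raddf_sum.
  rewrite [RHS]big_mkcond; apply: eq_bigr => d _ /=.
  have h : l * pihomog mdeg d g \is d.+1.-homog.
    by rewrite -add1n; apply: dhomogM => //; apply: pihomogP.
  case: eqP => [<-|/eqP ne]; first exact: pihomog_dE.
  exact: (pihomog_ne0 ne).
exists (\sum_(d < msize g | d.+1 == e) pihomog mdeg d g); split.
- by rewrite E mulr_sumr.
- by apply: rpred_sum => d /eqP <-; apply: pihomogP.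
case: e E {lge} => // E; move: lg0; rewrite E big1 ?eqxx // => d.
Qed.

(** * Nonzero values of nonzero polynomials in characteristic zero *)

Section Infinite.
Variables (k : fieldType) (char0 : [pchar k] =i pred0).

Lemma natr_inj : injective (fun i : nat => i%:R : k).
Proof.
have natr0 := (pcharf0P k).1 char0.
move=> i j; wlog le_ij : i j / (i <= j)%N => [W|].
  by case: (leqP i j) => [/W//|/ltnW /W h /esym/h].
move/esym/eqP; rewrite -subr_eq0 -natrB // natr0 subn_eq0 => le_ji.
by apply/eqP; rewrite eqn_leq le_ij.
Qed.

(** The integers below [size p] stay distinct in k and are too many to be all roots. *)
Lemma poly_nonroot (p : {poly k}) : p != 0 -> exists x, p.[x] != 0.
Proof.
move=> p0; apply/not_existsP => h.
have: (size [seq i%:R : k | i <- iota 0 (size p)] < size p)%N.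
  apply: max_poly_roots => //; last by rewrite map_inj_uniq ?iota_uniq //; apply: natr_inj.
  by apply/allP => x _; rewrite rootE; apply/negPn/negP/h.
by rewrite size_map size_iota ltnn.
Qed.

Lemma mcoeff_muni (n : nat) (f : {mpoly k[n.+1]}) (m : 'X_{1..n.+1}) :
  ((muni f)`_(m ord_max))@_[multinom m (widen_ord (leqnSn n) i) | i < n] = f@_m.
Proof.
rewrite muniE coef_sum raddf_sum /= [in RHS](mpolyE f) raddf_sum /=.
apply: eq_bigr => m' _; rewrite !coefZ coefXn mcoeffZ mcoeffX.
have [->|ne] := eqVneq m' m.
  by rewrite eqxx mulr1 mcoeffZ mcoeffX eqxx.
case: eqP => [E|_]; last by rewrite mulr0 mcoeff0 mulr0.
rewrite mulr1 mcoeffZ mcoeffX; case: eqP => // /mnmP E'.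
case/eqP: ne; apply/mnmP => i; case: (unliftP ord_max i) => [j ->|-> //].
have := E' j; rewrite !mnmE; suff -> : widen_ord (leqnSn n) j = lift ord_max j by [].
by apply: val_inj; rewrite /= /bump leqNgt ltn_ord.
Qed.

(** Induction on the number of variables: [muni] makes [f] univariate in the last variable, and the
    other variables are specialized first so that some coefficient survives. *)
Lemma mpoly_nonroot (n : nat) (f : {mpoly k[n]}) :
  f != 0 -> exists v, f.@[v] != 0.
Proof.
elim: n f => [|n ih] f f0.
  exists (fun=> 0); apply: contraNneq f0 => E.
  apply/eqP/mpolyP => m; rewrite mcoeff0.
  have -> : m = 0%MM by apply/mnmP; case.
  have h : f = (f@_0)%:MP.
    apply/mpolyP => m'; rewrite mcoeffC.
    have -> : m' = 0%MM by apply/mnmP; case.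
    by rewrite eqxx mulr1.
  by move: E; rewrite h mevalC mcoeffC eqxx mulr1.
have [m fm] : exists m, f@_m != 0.
  apply/not_existsP => h; case/eqP: f0; apply/mpolyP => m.
  by rewrite mcoeff0; apply/eqP/negPn/negP/h.
rewrite -mcoeff_muni in fm.
have /ih [v fv] : (muni f)`_(m ord_max) != 0.
  by apply: contraNneq fm => ->; rewrite mcoeff0.
have /poly_nonroot [x fx] : map_poly (meval v) (muni f) != 0.
  by apply: contraNneq fv => /polyP/(_ (m ord_max)); rewrite coef_map coef0 /= => ->.
(* The successive specializations compose to one ring morphism; its values at the variables are the
   coordinates of the point. *)
move: fx; rewrite -horner_evalE.
rewrite [map_poly _ _]rmorph_mmap rmorph_mmap.
set h := (X in mmap _ X f); set io := (X in mmap X _ f).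
move=> fx; exists h; congr (_ != 0): fx; apply: mmap_eqr => // c.
by rewrite /io /= map_polyC /= mevalC horner_evalE hornerC.
Qed.

End Infinite.

(** * Vanishing order at a point *)

Section Expansion.
Variables (R : nzRingType) (n : nat) (A : comNzRingType).

(** The polynomial f(p + X v), that is, [f] restricted to the line through p with direction v.
    Through [iota] the coordinates of p or v may be taken generic. *)
Definition expand (iota : R -> A) (p v : 'I_n -> A) (f : {mpoly R[n]}) : {poly A} :=
  mmap (polyC \o iota) (fun i => (p i)%:P + 'X * (v i)%:P) f.

Lemma map_expand (B : comNzRingType) (phi : {rmorphism A -> B}) (iota : R -> A) p v f :
  map_poly phi (expand iota p v f) =
  mmap (polyC \o (phi \o iota)) (fun i => (phi (p i))%:P + 'X * (phi (v i))%:P) f.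
Proof.
rewrite /expand rmorph_mmap; apply: mmap_eqr => i /=; first by rewrite map_polyC.
by rewrite rmorphD rmorphM /= !map_polyC map_polyX.
Qed.

End Expansion.

Section Vanishing.
Variables (k : fieldType) (n : nat).
Implicit Types (f g l : {mpoly k[n]}) (p v : 'I_n -> k) (m : nat).

(** Multiplicity at least m at p, tested on all lines through p. Over an infinite field this is the
    usual notion, and it is a system of linear conditions on [f]. *)
Definition vanishes m f p := forall v, 'X^m %| expand idfun p v f.

Lemma expandM p v f g : expand idfun p v (f * g) = expand idfun p v f * expand idfun p v g.
Proof. exact: rmorphM. Qed.

Lemma expand_horner0 p v f : (expand idfun p v f).[0] = f.@[p].
Proof.
rewrite -horner_evalE [LHS]rmorph_mmap; apply: mmap_eqr => i /=.
  by rewrite horner_evalE hornerC.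
by rewrite horner_evalE !hornerE ?mul0r ?addr0.
Qed.

Lemma vanishes0 f p : vanishes 0 f p.
Proof. by move=> v; rewrite expr0 dvd1p. Qed.

Lemma vanishes1 f p : f.@[p] = 0 -> vanishes 1 f p.
Proof.
by move=> fp v; rewrite expr1 -['X]subr0 -polyC0 dvdp_XsubCl rootE expand_horner0 fp.
Qed.

Lemma vanishes1_eval m f p : vanishes m.+1 f p -> f.@[p] = 0.
Proof.
move=> /(_ (fun=> 0)) h; apply/eqP; rewrite -(expand_horner0 p (fun=> 0)) -rootE.
by rewrite -dvdp_XsubCl polyC0 subr0 (dvdp_trans _ h) // exprS dvdp_mulr.
Qed.

Lemma vanishesD m f g p : vanishes m f p -> vanishes m g p -> vanishes m (f + g) p.
Proof. by move=> hf hg v; rewrite /expand mmapD dvdp_add ?hf ?hg. Qed.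

Lemma vanishesM m m' f g p :
  vanishes m f p -> vanishes m' g p -> vanishes (m + m') (f * g) p.
Proof. by move=> hf hg v; rewrite expandM exprD dvdp_mul ?hf ?hg. Qed.

Lemma vanishes_mull m f g p : vanishes m g p -> vanishes m (f * g) p.
Proof. by move=> hg; rewrite -[m]add0n; apply: vanishesM => //; apply: vanishes0. Qed.

(** On each line through p, [f] has a nonzero constant term, so it is coprime to X and cancels. *)
Lemma vanishes_unit m f g p : f.@[p] != 0 -> vanishes m (f * g) p -> vanishes m g p.
Proof.
move=> fp hfg v; have := hfg v; rewrite expandM Gauss_dvdpr //.
apply: coprimep_expl; rewrite -['X]subr0 -polyC0 coprimep_sym coprimep_XsubC rootE.
by rewrite expand_horner0.
Qed.

(** From f(cp + X cv) = c^e f(p + X v): for forms, the choice of homogeneous coordinates is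
    immaterial. *)
Lemma vanishes_scale m e f p c : f \is e.-homog -> c != 0 ->
  vanishes m f (fun i => c * p i) -> vanishes m f p.
Proof.
move=> fe c0 h v; have := h (fun i => c * v i).
have -> : expand idfun (fun i => c * p i) (fun i => c * v i) f
        = c%:P ^+ e * expand idfun p v f.
  rewrite /expand -(mmap_scale _ _ _ fe); apply: mmap_eqr => // i.
  by rewrite !polyCM; ring.
by rewrite -rmorphXn /= mul_polyC dvdpZr // expf_neq0.
Qed.

Lemma vanishes_coef m f p :
  vanishes m f p <-> forall v j, (j < m)%N -> (expand idfun p v f)`_j = 0.
Proof.
split=> h v.
  by move=> j jm; have /dvdpP[q ->] := h v; rewrite coefMXn jm.
apply/dvdpP; exists (drop_poly m (expand idfun p v f)).
rewrite -[LHS](poly_take_drop m) -[RHS]add0r; congr (_ + _).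
by apply/polyP => j; rewrite coef_take_poly coef0; case: ifP => // /h.
Qed.

Lemma expand_generic p v f :
  expand idfun p v f =
  map_poly (meval v) (expand (@mpolyC n k) (fun i => (p i)%:MP) (fun i => 'X_i) f).
Proof.
rewrite map_expand; apply: mmap_eqr => i /=; first by rewrite mevalC.
by rewrite mevalC mevalXU.
Qed.

Lemma dhomog1_linear l : l \is 1.-homog -> l = \sum_i l@_(U_(i))%MM *: 'X_i.
Proof.
move=> l1; apply/mpolyP => m; rewrite raddf_sum /=.
have [/mdeg1P[i /eqP ->]|m1] := boolP (mdeg m == 1%N); last first.
  rewrite (dhomog_nemf_coeff l1 m1) big1 // => i _.
  rewrite mcoeffZ mcoeffX; case: eqP => [E|_]; last by rewrite mulr0.
  by rewrite -E mdeg1 in m1.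
rewrite (bigD1 i) //= mcoeffZ mcoeffX eqxx mulr1 big1 ?addr0 // => j ji.
by rewrite mcoeffZ mcoeffX eq_mnm1 (negPf ji) mulr0.
Qed.

Lemma expand_linear p v l : l \is 1.-homog ->
  expand idfun p v l = (l.@[p])%:P + 'X * (l.@[v])%:P.
Proof.
move=> /dhomog1_linear El.
have mm (B : comNzRingType) (io : {rmorphism k -> B}) h :
    mmap io h l = \sum_i io l@_(U_(i))%MM * h i.
  rewrite {1}El raddf_sum; apply: eq_bigr => i _.
  by rewrite /= mmapZ mmapX mmap1U.
rewrite [LHS](mm _ (polyC \o idfun)) /meval !(mm _ idfun) !rmorph_sum mulr_sumr -big_split.
by apply: eq_bigr => i _ /=; rewrite !polyCM; ring.
Qed.

End Vanishing.

(** Linear forms carry the line p + X v to the line L(p) + X L(v). *)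
Lemma vanishes_comp (k : fieldType) n n' m (f : {mpoly k[n']})
    (L : n'.-tuple {mpoly k[n]}) (p : 'I_n -> k) :
  (forall i, tnth L i \is 1.-homog) ->
  vanishes m f (fun i => (tnth L i).@[p]) -> vanishes m (f \mPo L) p.
Proof.
move=> L1 h v; have := h (fun i => (tnth L i).@[v]).
rewrite /comp_mpoly [expand _ _ _ (mmap _ _ _)]rmorph_mmap.
suff -> : expand idfun (fun i => (tnth L i).@[p]) (fun i => (tnth L i).@[v]) f =
  mmap (expand idfun p v \o @mpolyC n k) (expand idfun p v \o tnth L) f by [].
apply: mmap_eqr => i /=; first by rewrite /expand mmapC.
by rewrite expand_linear.
Qed.

Section VanishingLinear.
Variables (k : fieldType) (char0 : [pchar k] =i pred0) (n : nat).

(** As l(p) = 0, the coefficient of X^(j+1) in the expansion of l g is l(v) G_j(v). A given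
    direction may lie in the hyperplane l = 0, so v is made generic: the polynomial l G_j takes only
    the value zero, hence is zero, and l cancels. *)
Lemma vanishes_linear_factor m (l g : {mpoly k[n]}) p :
  l \is 1.-homog -> l != 0 -> l.@[p] = 0 -> vanishes m.+1 (l * g) p -> vanishes m g p.
Proof.
move=> l1 l0 lp h; apply/vanishes_coef => v j jm.
pose G := expand (@mpolyC n k) (fun i => (p i)%:MP) (fun i => 'X_i) g.
suff G0 : G`_j = 0 by rewrite expand_generic coef_map -/G G0 /= meval0.
apply/eqP; suff : l * G`_j == 0 by rewrite mulf_eq0 (negPf l0).
apply/contraT => /(mpoly_nonroot char0)[w /eqP[]].
have := (vanishes_coef _ _ _).1 h w j.+1 jm.
rewrite expandM (expand_linear _ _ l1) lp add0r -mulrA coefXM /= coefCM.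
by rewrite expand_generic coef_map mevalM.
Qed.

Lemma vanishes_linear_factorX m b (l g : {mpoly k[n]}) p :
  l \is 1.-homog -> l != 0 -> l.@[p] = 0 -> vanishes m (l ^+ b * g) p -> vanishes (m - b) g p.
Proof.
move=> l1 l0 lp; elim: b m => [|b ih] m; first by rewrite subn0 mul1r.
case: m => [|m]; first by move=> _; rewrite sub0n; apply: vanishes0.
by rewrite exprS -mulrA => /vanishes_linear_factor => /(_ l1 l0 lp)/ih.
Qed.

End VanishingLinear.

(** * Star configurations *)

Section Star.
Variables (k : fieldType) (char0 : [pchar k] =i pred0).
Implicit Types (t : k) (p q : {poly k}) (T S : seq k).

(* A polynomial p of degree at most N is identified with the point of P^N whose
   coordinates are its coefficients. Then evalform N t is the linear form p |-> p(t),
   and hyperplane N t below is the isomorphism q |-> (X - t) q of P^N onto the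
   hyperplane p(t) = 0 of P^(N+1). *)
Definition evalform N t : {mpoly k[N.+1]} := \sum_(i < N.+1) t ^+ i *: 'X_i.

Lemma evalform_homog N t : evalform N t \is 1.-homog.
Proof. by apply: rpred_sum => i _; apply: rpredZ; rewrite dhomogX /= mdeg1. Qed.

Lemma meval_evalform N t p :
  (size p <= N.+1)%N -> (evalform N t).@[fun i => p`_i] = p.[t].
Proof.
move=> sp; rewrite (horner_coef_wide _ sp) raddf_sum.
by apply: eq_bigr => i _; rewrite /= mevalZ mevalXU mulrC.
Qed.

Definition hyperplane N t : N.+2.-tuple {mpoly k[N.+1]} :=
  [tuple (('X - (t%:MP)%:P) * \poly_(i < N.+1) 'X_(inord i))`_j | j < N.+2].

(** The target ring is arbitrary so as to cover both points of P^N and the generic quotient in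
    [evalform_dvd]. *)
Lemma rmorph_hyperplane N t (A : comNzRingType) (phi : {rmorphism {mpoly k[N.+1]} -> A})
    (q : {poly A}) (j : 'I_N.+2) :
  (size q <= N.+1)%N -> (forall i : 'I_N.+1, phi 'X_i = q`_i) ->
  phi (tnth (hyperplane N t) j) = (('X - (phi t%:MP)%:P) * q)`_j.
Proof.
move=> sq hq; rewrite tnth_mktuple -coef_map rmorphM rmorphB /= map_polyX map_polyC.
suff -> : map_poly phi (\poly_(i < N.+1) 'X_(inord i)) = q by [].
apply/polyP => i; rewrite coef_map coef_poly.
case: ltnP => iN; last by rewrite raddf0 nth_default // (leq_trans sq).
by have := hq (inord i); rewrite inordK.
Qed.

Lemma meval_hyperplane N t q (j : 'I_N.+2) : (size q <= N.+1)%N ->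
  (tnth (hyperplane N t) j).@[fun i => q`_i] = (('X - t%:P) * q)`_j.
Proof.
by move=> sq; rewrite (rmorph_hyperplane _ _ sq) /= ?mevalC // => i; rewrite mevalXU.
Qed.

Lemma hyperplane_homog N t (j : 'I_N.+2) : tnth (hyperplane N t) j \is 1.-homog.
Proof.
rewrite tnth_mktuple mulrBl coefB coefXM coefCM !coef_poly.
have X1 i : ('X_i : {mpoly k[N.+1]}) \is 1.-homog by rewrite dhomogX /= mdeg1.
have P1 (i : nat) (b : bool) :
    (if b then 'X_(inord i) else 0 : {mpoly k[N.+1]}) \is 1.-homog.
  by case: b; rewrite ?X1 ?rpred0.
apply: rpredB; first by case: eqP => _; rewrite ?rpred0 ?P1.
by rewrite mul_mpolyC; apply: rpredZ.
Qed.

(** Let P have generic coefficients. Then P - P(t) = (X - t) q, where P(t) is the form [evalform].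
    Modulo this form the generic point P agrees with (X - t) q, which lies on the hyperplane, so
    f(P) is congruent to 0. *)
Lemma evalform_dvd N t (f : {mpoly k[N.+2]}) :
  f \mPo hyperplane N t = 0 -> exists g, f = evalform N.+1 t * g.
Proof.
move=> f0; pose P : {poly {mpoly k[N.+2]}} := \poly_(i < N.+2) 'X_(inord i).
have Pt : P.[t%:MP] = evalform N.+1 t.
  rewrite /evalform horner_poly; apply: eq_bigr => i _.
  by rewrite inord_val -rmorphXn mulrC mul_mpolyC.
have /factor_theorem[q Eq] : root (P - P.[t%:MP]%:P) t%:MP.
  by rewrite rootE !hornerE subrr.
have sP : (size P <= N.+2)%N by apply: size_poly.
have sq : (size q <= N.+1)%N.
  have [->|q0] := eqVneq q 0; first by rewrite size_poly0.
  have : (size (P - P.[t%:MP]%:P)%R <= N.+2)%N.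
    rewrite (leq_trans (size_polyD _ _)) // size_polyN geq_max sP.
    by rewrite (leq_trans (size_polyC_leq1 _)).
  by rewrite Eq size_Mmonic ?monicXsubC // size_XsubC addn2.
pose L := [tuple q`_i | i < N.+1].
have := congr1 (comp_mpoly L) f0; rewrite raddf0 /= {1}/comp_mpoly.
rewrite [X in mmap _ _ X]/comp_mpoly -/(comp_mpoly L _) [LHS]rmorph_mmap => E0.
have [i|g Eg] := @mmap_congr _ _ _ (comp_mpoly L \o @mpolyC _ _) (fun i => 'X_i)
  (comp_mpoly L \o tnth (hyperplane N t)) (evalform N.+1 t) f.
  (* P and (X - t) q differ only in the constant coefficient, by P(t). *)
  rewrite /= (rmorph_hyperplane _ _ sq); last first.
    by move=> j; rewrite [LHS]comp_mpolyXU -tnth_nth tnth_mktuple.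
  rewrite /= comp_mpolyC mulrC -Eq coefB coefC coef_poly ltn_ord inord_val Pt.
  by exists (val i == 0%N)%:R; rewrite opprB addrC subrK; case: eqP; rewrite ?mulr1 ?mulr0.
exists g; rewrite -Eg E0 subr0 -[LHS]comp_mpoly_id.
by apply: mmap_eqr => i /=; rewrite ?comp_mpolyC ?tnth_mktuple.
Qed.

(** At the point q = 1 the restricted form takes the value u - t. *)
Lemma evalform_comp_neq0 N t u : u != t -> evalform N.+1 u \mPo hyperplane N t != 0.
Proof.
move=> ut; apply: contraNneq ut => /(congr1 (meval (fun i => (1 : {poly k})`_i))).
rewrite meval0 comp_mpoly_meval => /eqP.
have -> : (evalform N.+1 u).@[fun j => (tnth (hyperplane N t) j).@[fun i => (1 : {poly k})`_i]]
        = ('X - t%:P).[u].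
  rewrite -(@meval_evalform N.+1) ?size_XsubC //; apply: meval_eq => j.
  by rewrite meval_hyperplane ?mulr1 // size_poly1.
by rewrite !hornerE subr_eq0.
Qed.

Lemma evalform_neq0 N t : evalform N t != 0.
Proof.
apply/eqP => /(congr1 (meval (fun i => (1 : {poly k})`_i))).
rewrite meval0 meval_evalform ?size_poly1 // hornerC => /eqP.
by rewrite oner_eq0.
Qed.

(** A factor is split off as long as some restriction vanishes; the degree drops each time. Thus
    [a t] is the exact order of [f] along the hyperplane of t. *)
Lemma factor_evalforms N T e (f : {mpoly k[N.+2]}) :
  uniq T -> f != 0 -> f \is e.-homog ->
  exists (a : k -> nat) (d : nat) (g : {mpoly k[N.+2]}),
    [/\ f = \prod_(t <- T) evalform N.+1 t ^+ a t * g, g \is d.-homog,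
        e = (\sum_(t <- T) a t + d)%N &
        {in T, forall t, g \mPo hyperplane N t != 0}].
Proof.
move=> uT; have [n] := ubnP e; elim: n e f => // n ih e f /ltnSE en f0 fe.
case: (pselect (forall t, t \in T -> f \mPo hyperplane N t != 0)) => [h|].
  by exists (fun=> 0%N), e, f; split; rewrite ?big1 ?mul1r.
move/existsNP=> [t /not_implyP[tT /negP]]; rewrite negbK => /eqP/evalform_dvd[g Eg].
move: f0 fe; rewrite Eg => f0 fe.
have [g' [Eg' g'e e0]] := dhomog_factor (evalform_homog _ _) fe f0.
have g'0 : g' != 0 by apply: contraNneq f0 => g'0; rewrite Eg' g'0 mulr0.
have lt_en : (e.-1 < n)%N by rewrite prednK.
have [a [d [h [Eh hd Ed hT]]]] := ih _ g' lt_en g'0 g'e.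
exists (fun x => (x == t) + a x)%N, d, h; split=> //.
  rewrite Eg' Eh mulrA; congr (_ * _).
  under [RHS]eq_bigr => x _ do rewrite exprD.
  rewrite big_split /=; congr (_ * _).
  by rewrite (bigD1_seq t) //= eqxx big1 ?mulr1 // => x /negPf ->.
rewrite big_split /= (bigD1_seq t) //= eqxx big1 => [|x /negPf ->] //.
by rewrite -addnA -Ed add1n prednK.
Qed.

(** For [size S] = N, this is the point of P^N where the hyperplanes p(t) = 0, t in S, meet. *)
Definition rootpoly S : {poly k} := \prod_(t <- S) ('X - t%:P).

(** Induction on the dimension. In P^0 the only point comes from the empty S, and a nonzero form
    does not vanish there, so m = 0. The bound m <= e settles the case of a single hyperplane, where
    the summation below would divide by |T| - 1 = 0. *)
Lemma star_bound N T e m (f : {mpoly k[N.+1]}) :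
  uniq T -> (N <= size T)%N -> f != 0 -> f \is e.-homog ->
  (forall S, uniq S -> size S = N -> {subset S <= T} ->
     vanishes m f (fun i => (rootpoly S)`_i)) ->
  (size T * m <= N * e /\ m <= e)%N.
Proof.
elim: N T e m f => [|N ih] T e m f uT sT f0 fe fv.
  suff -> : m = 0%N by rewrite muln0.
  case: m fv => // m fv.
  have /vanishes1_eval f1 : vanishes m.+1 f (fun i => (rootpoly [::])`_i) by apply: fv.
  have /(mpoly_nonroot char0)[v] := f0; rewrite /meval.
  have -> : mmap idfun v f = mmap idfun (fun i => v ord0 * (rootpoly [::])`_i) f.
    apply: mmap_eqr => // i; rewrite /rootpoly big_nil ord1 coefC mulr1.
    by congr v; apply: val_inj.
  by rewrite (mmap_scale _ _ _ fe) -/(meval _ _) f1 mulr0 eqxx.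
have [a [d [g [Ef gd Ee gT]]]] := factor_evalforms uT f0 fe.
(* Dividing by the exact power of evalform t and restricting to its hyperplane gives
   a nonzero form on the star configuration of the other hyperplanes. *)
have step t : t \in T ->
    ((size T).-1 * (m - a t) <= N * (e - a t) /\ m - a t <= e - a t)%N.
  move=> tT; have sT' : size (rem t T) = (size T).-1 by rewrite size_rem.
  pose f' := \prod_(u <- T | u != t) evalform N.+1 u ^+ a u * g.
  have Ef' : f = evalform N.+1 t ^+ a t * f' by rewrite Ef (bigD1_seq t) //= mulrA.
  rewrite -sT'; apply: (ih _ _ _ (f' \mPo hyperplane N t)).
  - exact: rem_uniq.
  - by rewrite sT'; lia.
  - rewrite rmorphM mulf_neq0 ?gT // rmorph_prod prodf_seq_neq0.
    by apply/allP => u _; apply/implyP => ut; rewrite rmorphXn expf_neq0 // evalform_comp_neq0.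
  - apply: dhomog_comp; first exact: hyperplane_homog.
    rewrite Ee (bigD1_seq t) //= -addnA addKn; apply: dhomogM => //.
    elim/big_rec2: _ => [|u i j _ ij]; first exact: dhomog1.
    apply: dhomogM => //; have := dhomogMn (a u) (evalform_homog N.+1 u).
    by rewrite mul1n.
  move=> S uS sS ST; apply: vanishes_comp; first exact: hyperplane_homog.
  have sr : (size (rootpoly S) <= N.+1)%N.
    by rewrite /rootpoly size_prod_XsubC sS.
  have tS : t \notin S by apply/negP => /ST; rewrite mem_rem_uniq // inE eqxx.
  have := fv (t :: S); rewrite /= tS uS sS => /(_ isT erefl) h.
  have {}h : vanishes m f (fun i => (rootpoly (t :: S))`_i).
    by apply: h => x; rewrite inE => /orP[/eqP ->//|/ST/mem_rem].
  (* The point of t :: S is the image of the point of S under [hyperplane N t]. It lies on the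
     hyperplane of t, so each factor [evalform] of t lowers the multiplicity by at most one. *)
  suff : vanishes (m - a t) f' (fun i => (rootpoly (t :: S))`_i).
    have -> // : (fun i : 'I_N.+2 => (rootpoly (t :: S))`_i) =
      (fun i => (tnth (hyperplane N t) i).@[fun i => (rootpoly S)`_i]).
    by apply: funext => i; rewrite meval_hyperplane // /rootpoly big_cons.
  move: h; rewrite Ef'; apply: vanishes_linear_factorX => //.
  - exact: evalform_homog.
  - exact: evalform_neq0.
  rewrite meval_evalform /rootpoly ?size_prod_XsubC /= ?sS //.
  by rewrite big_cons !hornerE subrr mul0r.
have at_le t : t \in T -> (a t <= e)%N.
  by move=> tT; rewrite Ee (bigD1_seq t) //= -addnA leq_addr.
have me : (m <= e)%N.
  case: T uT sT step at_le {Ef Ee gT fv} => // t T _ _ /(_ t) + /(_ t).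
  by rewrite mem_head => /(_ isT)[_ h] /(_ isT) ate; rewrite leq_sub2rE in h.
split=> //.
have [s1|s1] := leqP (size T) 1.
  suff [-> ->] : size T = 1%N /\ N = 0%N by rewrite !mul1n.
  by split; lia.
(* This removes the truncated subtractions of [step]: for a t <= m it is a rearrangement, and for a
   t > m it follows from m < a t <= e. *)
have key t : t \in T ->
    ((size T).-1 * m <= N * e + ((size T).-1 - N) * a t)%N.
  move=> tT; have [h _] := step t tT; have ate := at_le t tT.
  have [mat|mat] := leqP (a t) m; first by nia.
  have : ((size T).-1 * m <= (size T).-1 * a t)%N by rewrite leq_mul2l (ltnW mat) orbT.
  by nia.
(* Put r = |T| - 1. After summation, the orders adding up to at most e, the right side is at most (r
   + 1) N e + (r - N) e = r (N + 1) e, and r > 0 cancels. *)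
have : (\sum_(t <- T) (size T).-1 * m <= \sum_(t <- T) (N * e + ((size T).-1 - N) * a t))%N.
  by rewrite big_seq [X in (_ <= X)%N]big_seq; apply: leq_sum.
rewrite big_split /= -[X in (_ + X)%N]big_distrr /= !big_const_seq count_predT !iter_addn_0.
have : (\sum_(t <- T) a t <= e)%N by rewrite Ee leq_addr.
move: (\sum_(t <- T) a t)%N => s se.
case: (size T) s1 sT => // r; rewrite /= !ltnS => r0 Nr h.
have le_se : ((r - N) * s <= (r - N) * e)%N by rewrite leq_mul2l se orbT.
have rE : (r * (N.+1 * e) = N * e * r.+1 + (r - N) * e)%N by nia.
have : (r * (r.+1 * m) <= r * (N.+1 * e))%N.
  by rewrite rE (leq_trans (leq_trans _ h)) ?leq_add2l //; nia.
by rewrite leq_pmul2l.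
Qed.

End Star.

(** * Linear conditions on forms *)

(** Rows are added greedily: while the rank is below r, a nonzero column of the cokernel is killed
    by all chosen rows, and a form of [L] not vanishing on it is independent of them. *)
Lemma unitmx_of_separating (k : fieldType) (r : nat) (L : 'rV[k]_r -> Prop) :
  (forall u : 'cV[k]_r, u != 0 -> exists2 l, L l & l *m u != 0) ->
  exists2 A : 'M[k]_r, forall a, L (row a A) & A \in unitmx.
Proof.
move=> sep; suff : forall j, (j <= r)%N ->
    exists2 A : 'M[k]_(j, r), forall a, L (row a A) & \rank A = j.
  by move=> /(_ r (leqnn r))[A LA rA]; exists A; rewrite // -row_free_unit /row_free rA.
elim=> [|j ih] jr; first by exists 0; [case | rewrite mxrank0].
have [A LA rA] := ih (ltnW jr).
have : cokermx A != 0 by rewrite -mxrank_eq0 mxrank_coker rA subn_eq0 -ltnNge.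
case/matrix0Pn => i [c Aic].
have [|l Ll lu] := sep (col c (cokermx A)).
  by apply/matrix0Pn; exists i, 0; rewrite mxE.
have lA : ~~ (l <= A)%MS.
  apply: contraNN lu => /submxP[w ->].
  by rewrite colE mulmxA -(mulmxA w A) mulmx_coker mulmx0 mul0mx.
rewrite -addn1; exists (col_mx A l) => [a|].
  case: (split_ordP a) => b ->; first by rewrite rowKu.
  rewrite rowKd (_ : row b l = l) //.
  by apply/rowP => i'; rewrite mxE ord1.
have rlt : (\rank A < \rank (col_mx A l))%N.
  rewrite -addsmxE; apply: rank_ltmx.
  by rewrite ltmxE addsmxSl addsmx_sub submx_refl.
by apply/eqP; rewrite eqn_leq rank_leq_row (leq_trans _ rlt) // rA addn1.
Qed.

Section Forms.
Import VectorInternalTheory.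
Variables (k : fieldType) (N e : nat).
Local Notation V := (dhomog N.+1 k e).

(* The forms of degree e, by coordinates; dim V reduces to 'C(e + N, e). *)
Definition hform (u : 'rV[k]_(dim V)) : {mpoly k[N.+1]} := mpoly_of_dhomog (r2v u : V).

Definition hform_basis (b : 'I_(dim V)) := hform (delta_mx 0 b).

Lemma hform_homog u : hform u \is e.-homog.
Proof. exact: dhomog_is_dhomog. Qed.

Lemma hform_eq0 u : (hform u == 0) = (u == 0).
Proof.
apply/eqP/eqP => [E|->]; last by rewrite /hform !linear0.
by apply: (can_inj r2vK); rewrite linear0; apply: val_inj.
Qed.

Lemma hform_surj f : f \is e.-homog -> exists u, f = hform u.
Proof. by move=> fe; exists (v2r (DHomog fe : V)); rewrite /hform v2rK. Qed.

Lemma hformE u : hform u = \sum_b u 0 b *: hform_basis b.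
Proof.
rewrite {1}(row_sum_delta u) /hform !linear_sum.
by apply: eq_bigr => b _; rewrite !linearZ.
Qed.

Lemma meval_hform u x : (hform u).@[x] = \sum_b u 0 b * (hform_basis b).@[x].
Proof. by rewrite hformE raddf_sum; apply: eq_bigr => b _; rewrite /= mevalZ. Qed.

End Forms.

(** * Openness of the absence of multiple forms *)

Lemma mxvec_index_inj (m n : nat) (i i' : 'I_m) (j j' : 'I_n) :
  mxvec_index i j = mxvec_index i' j' -> (i, j) = (i', j').
Proof. by move/cast_ord_inj/enum_rank_inj. Qed.

Section BlockWeight.
Variables (n M : nat) (i : 'I_n).

(** The degree in the coordinates of point i. Made a measure on monomials, it turns homogeneity in
    one point into an instance of weighted homogeneity. *)
Definition block_weight (m : 'X_{1..n * M}) : nat := \sum_(j < M) m (mxvec_index i j).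

Lemma block_weight0 : block_weight 0%MM = 0%N.
Proof. by apply: big1 => j _; rewrite mnm0E. Qed.

Lemma block_weightD : {morph block_weight : m1 m2 / (m1 + m2)%MM >-> (m1 + m2)%N}.
Proof.
by move=> m1 m2; rewrite /block_weight -big_split; apply: eq_bigr => j _; rewrite mnmDE.
Qed.

HB.instance Definition _ := isMeasure.Build (n * M) block_weight block_weight0 block_weightD.

Lemma block_weightU i' j : block_weight U_(mxvec_index i' j)%MM = (i' == i) :> nat.
Proof.
rewrite /block_weight; under eq_bigr => l _ do rewrite mnm1E.
rewrite (bigD1 j) //= big1 ?addn0 => [|l lj].
  have [->|ne] := eqVneq i' i; first by rewrite eqxx.
  by case: eqP => // /mxvec_index_inj[E]; rewrite E eqxx in ne.
by case: eqP => // /mxvec_index_inj[_ E]; rewrite E eqxx in lj.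
Qed.

End BlockWeight.

Section Determinantal.
Local Open Scope quotient_scope.
Local Open Scope classical_set_scope.
Local Open Scope ring_scope.
Variables (k : fieldType) (N n e : nat).
Local Notation PN := (proj_space k N).
Local Notation MP := {mpoly k[n * N.+1]}.
Implicit Types (s : n.-tuple PN) (i : 'I_n) (v : 'I_N.+1 -> k).

Definition hcoords s i : 'I_N.+1 -> k := fun j => coords (tnth s i) 0 j.

Definition generic_expand i v (f : {mpoly k[N.+1]}) : {poly MP} :=
  expand (@mpolyC (n * N.+1) k) (fun j => 'X_(mxvec_index i j)) (fun j => (v j)%:MP) f.

Lemma multi_coordsE s i j : multi_coords s (mxvec_index i j) = hcoords s i j.
Proof. by rewrite /multi_coords mxvecE mxE. Qed.

Lemma map_generic_expand s i v f :
  map_poly (meval (multi_coords s)) (generic_expand i v f) = expand idfun (hcoords s i) v f.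
Proof.
rewrite map_expand; apply: mmap_eqr => j /=; first by rewrite mevalC.
by rewrite mevalXU mevalC multi_coordsE.
Qed.

(* With c = 1 (resp. 0): q_j has degree d - j (resp. 0) in the coordinates of point i0. *)
Definition coef_homog i0 (c d : nat) (q : {poly MP}) := forall j,
  ((d < j)%N -> q`_j = 0) /\ q`_j \is (c * (d - j)).-homog for (@block_weight n N.+1 i0).

Lemma coef_homogM i0 c d d' q q' :
  coef_homog i0 c d q -> coef_homog i0 c d' q' -> coef_homog i0 c (d + d') (q * q').
Proof.
move=> hq hq' j; rewrite coefM; split=> [dj|].
  apply: big1 => -[a /= aj] _; have [da|ad] := ltnP d a; first by rewrite (hq a).1 ?mul0r.
  by rewrite (hq' _).1 ?mulr0 //; lia.
apply: rpred_sum => -[a /= aj] _.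
have [da|ad] := ltnP d a; first by rewrite (hq a).1 // mul0r rpred0.
have [da'|ad'] := ltnP d' (j - a); first by rewrite (hq' _).1 // mulr0 rpred0.
have -> : (c * (d + d' - j) = c * (d - a) + c * (d' - (j - a)))%N.
  by rewrite -mulnDr; congr (_ * _)%N; lia.
by apply: dhomogM; [apply: (hq a).2 | apply: (hq' _).2].
Qed.

(** Each variable becomes a coordinate of point i plus a constant times X, so every factor X taken
    costs one degree in that point; this is checked on monomials. *)
Lemma generic_expand_homog i0 i v d f : f \is d.-homog ->
  coef_homog i0 (i == i0) d (generic_expand i v f).
Proof.
move=> /dhomogP fd; have const0 c a : coef_homog i0 a 0 (c%:MP)%:P.
  move=> j; rewrite coefC; case: j => [|j] /=; split=> //; last exact: rpred0.
  by rewrite muln0 -[c%:MP]mulr1 mul_mpolyC rpredZ // dhomog1.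
have X1 j : coef_homog i0 (i == i0) 1
    (('X_(mxvec_index i j))%:P + 'X * ((v j)%:MP)%:P : {poly MP}).
  move=> [|[|l]]; rewrite coefD coefC coefXM coefC /= ?addr0 ?add0r; split=> //.
  - by rewrite muln1 dhomogX /= block_weightU.
  - by rewrite muln0 -[_%:MP]mulr1 mul_mpolyC rpredZ // dhomog1.
  - exact: rpred0.
suff mon m : coef_homog i0 (i == i0) (mdeg m)
    (mmap1 (fun j => ('X_(mxvec_index i j))%:P + 'X * ((v j)%:MP)%:P : {poly MP}) m).
  move=> j; rewrite /generic_expand /expand /mmap big_seq; split=> [dj|].
    rewrite coef_sum; apply: big1 => m /fd /= Em.
    by rewrite coefCM (mon m j).1 ?mulr0 ?Em.
  rewrite coef_sum; apply: rpred_sum => m /fd /= Em.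
  by rewrite coefCM mul_mpolyC rpredZ // -Em; apply: (mon m j).2.
rewrite mdegE /mmap1; elim/big_rec2: _ => [|j d' q _ hq]; first exact: const0.
apply: coef_homogM => //; elim: (m j) => [|a ih]; first exact: const0.
by rewrite exprS -add1n; apply: coef_homogM.
Qed.

Definition has_multiple_form m s :=
  exists f, [/\ f != 0, f \is e.-homog & forall i, vanishes m f (hcoords s i)].

(* One linear condition on the forms of degree e: a point, an order j < m and a
   direction v, standing for the vanishing of the X^j-coefficient of f(p + X v). *)
Definition cond_index m := ('I_n * 'I_m * ('I_N.+1 -> k))%type.

(** The maximal minors of the infinite system of conditions, as polynomials in the coordinates of
    the n points: [r] is the dimension of the space of forms of degree e, and [c] selects the
    rows. *)
Definition cond_det m (r := 'C(e + N, e)) (c : 'I_r -> cond_index m) : MP :=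
  \det (\matrix_(a < r, b < r)
    (generic_expand (c a).1.1 (c a).2 (@hform_basis k N e b))`_(c a).1.2).

(** The degree of an entry depends on its row alone, so all terms of the determinant have the same
    multidegree. *)
Lemma cond_det_multihomogeneous m (c : 'I_('C(e + N, e)) -> cond_index m) :
  multihomogeneous (cond_det c).
Proof.
exists (fun i => \sum_a ((c a).1.1 == i) * (e - (c a).1.2))%N.
move=> mu + i; apply: (dhomog_mf (mf := @block_weight n N.+1 i)).
rewrite /cond_det /determinant; apply: rpred_sum => sg _.
have : \prod_a (\matrix_(a, b)
      (generic_expand (c a).1.1 (c a).2 (@hform_basis k N e b))`_(c a).1.2) a (sg a)
    \is (\sum_a ((c a).1.1 == i) * (e - (c a).1.2))%N.-homog for (@block_weight n N.+1 i).
  elim/big_rec2: _ => [|a d q _ hq]; first exact: dhomog1.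
  apply: dhomogM => //; rewrite mxE.
  by apply: (generic_expand_homog i _ _ (hform_homog _) _).2.
by rewrite mulr_sign; case: ifP => // _; rewrite rpredN.
Qed.

(** The forms sought are the common zeros of all conditions. If only zero remains, the conditions
    separate vectors and some r of them have nonzero determinant. *)
Lemma has_multiple_form_iff m s :
  has_multiple_form m s <-> forall c : _ -> cond_index m, (cond_det c).@[multi_coords s] = 0.
Proof.
pose row_of (x : cond_index m) : 'rV[k]_('C(e + N, e)) :=
  \row_b (expand idfun (hcoords s x.1.1) x.2 (@hform_basis k N e b))`_x.1.2.
have row_ofE x (u : 'cV_('C(e + N, e))) :
    (row_of x *m u) 0 0 = (expand idfun (hcoords s x.1.1) x.2 (@hform k N e u^T))`_x.1.2.
  rewrite (@hformE k N e u^T) /expand raddf_sum coef_sum mxE; apply: eq_bigr => b _.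
  by rewrite /= mmapZ /= coefCM !mxE mulrC.
have detE c : (cond_det c).@[multi_coords s] = \det (\matrix_a row_of (c a)).
  rewrite /cond_det -det_map_mx; congr (\det _); apply/matrixP => a b.
  by rewrite !mxE -coef_map map_generic_expand.
split=> [[f [f0 /hform_surj[u Ef] fv]] c|h].
  rewrite detE; apply/eqP; rewrite -det_tr; apply/det0P; exists u.
    by rewrite -(@hform_eq0 k N e) -Ef.
  apply/rowP => a; have -> : (u *m (\matrix_a row_of (c a))^T) 0 a = (row_of (c a) *m u^T) 0 0.
    by rewrite !mxE; apply: eq_bigr => b _; rewrite !mxE mulrC.
  by rewrite row_ofE trmxK -Ef mxE; apply/(vanishes_coef _ _ _).1.
apply/not_notP => nbad.
have [|A /fin_all_exists[c Ac]] := @unitmx_of_separating k _ (fun l => exists x, l = row_of x).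
  move=> u u0; apply/not_notP => hu; apply: nbad; exists (@hform k N e u^T).
  split; [|exact: hform_homog|].
    by rewrite hform_eq0 -(inj_eq trmx_inj) trmxK trmx0.
  move=> i; apply/vanishes_coef => v j jm; rewrite -(row_ofE (i, Ordinal jm, v)).
  have [->|ne] := eqVneq (row_of (i, Ordinal jm, v) *m u) 0; first by rewrite mxE.
  by case: hu; exists (row_of (i, Ordinal jm, v)); [exists (i, Ordinal jm, v)|].
have -> : A = \matrix_a row_of (c a) by apply/row_matrixP => a; rewrite rowK.
by rewrite unitmxE -detE h unitr0.
Qed.

Lemma has_multiple_form_closed m : closed_product (has_multiple_form m).
Proof.
exists (fun f => exists c : _ -> cond_index m, f = cond_det c); split.
  by move=> _ [c ->]; apply: cond_det_multihomogeneous.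
apply/seteqP; split=> s /=; first by move=> /has_multiple_form_iff h _ [c ->].
by move=> h; apply/has_multiple_form_iff => c; apply: h; exists c.
Qed.

Lemma has_multiple_form_perm m s s' :
  perm_eq s s' -> has_multiple_form m s -> has_multiple_form m s'.
Proof.
move=> ss' [f [f0 fe fv]]; exists f; split=> // i.
have : tnth s' i \in s by rewrite (perm_mem ss') mem_tnth.
by case/tnthP => j E; rewrite /hcoords E; apply: fv.
Qed.

(** Ranging over all orderings of the cycle makes its preimage the complement of a closed set stable
    under permutation. *)
Definition no_multiple_form m : set (chow0 k N n) :=
  fun c => forall s, cycle_of s = c -> ~ has_multiple_form m s.

Lemma no_multiple_form_open m : zariski_open (no_multiple_form m).
Proof.
have := has_multiple_form_closed m; congr closed_product; apply/seteqP; split=> s /= h.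
  by move=> /(_ s erefl).
apply/not_notP => nb; apply: h => s' /eqmodP /= ss' b.
by apply: nb; apply: has_multiple_form_perm b.
Qed.

End Determinantal.

(** * Density of nonempty open sets of cycles *)

Section Density.
Local Open Scope quotient_scope.
Local Open Scope classical_set_scope.
Local Open Scope ring_scope.
Variables (k : fieldType) (char0 : [pchar k] =i pred0) (N n : nat).
Local Notation PN := (proj_space k N).

Lemma coords_neq0 (p : PN) : coords p != 0.
Proof. exact: valP (repr p). Qed.

Lemma coords_inj (p q : PN) : (coords p <= coords q)%MS -> p = q.
Proof.
move=> pq; rewrite -[p]reprK -[q]reprK; apply/eqmodP.
rewrite /= /same_line -/(coords p) -/(coords q) pq /=.
by rewrite -(mxrank_leqif_sup pq).2 !rank_rV !coords_neq0.
Qed.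

Lemma point_of_row (u : 'rV[k]_N.+1) : u != 0 ->
  exists p : PN, exists2 c, c != 0 & coords p = c *: u.
Proof.
move=> u0; exists (\pi_PN (exist _ u u0 : nonzero_row k N)).
set p := \pi_PN _.
have /eqmodP : \pi_PN (repr p) = p by rewrite reprK.
rewrite /= /same_line -/(coords p) /= => /andP[/sub_rVP[c E] _].
by exists c => //; apply: contraNneq (coords_neq0 p) => c0; rewrite E c0 scale0r.
Qed.

(** The factors [c] absorb the choice of representatives made by [coords]. *)
Lemma tuple_of_rows (u : 'I_n -> 'rV[k]_N.+1) : (forall i, u i != 0) ->
  exists s : n.-tuple PN, exists c : 'I_n -> k,
    forall i, c i != 0 /\ forall j, hcoords s i j = c i * u i 0 j.
Proof.
move=> u0; have /fin_all_exists[p /fin_all_exists[c pc]] :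
    forall i, exists p : PN, exists c, c != 0 /\ coords p = c *: u i.
  by move=> i; have [p [c c0 E]] := point_of_row (u0 i); exists p, c.
exists [tuple p i | i < n], c => i; have [c0 E] := pc i; split=> // j.
by rewrite /hcoords tnth_mktuple E mxE.
Qed.

(** All monomials are multiplied by the same product of powers of the c_i. *)
Lemma multihomogeneous_scale (f : {mpoly k[n * N.+1]}) (c : 'I_n -> k)
    (x y : 'I_(n * N.+1) -> k) :
  multihomogeneous f -> (forall i, c i != 0) ->
  (forall i j, y (mxvec_index i j) = c i * x (mxvec_index i j)) ->
  f.@[x] != 0 -> f.@[y] != 0.
Proof.
move=> [d fd] c0 yx; suff -> : f.@[y] = (\prod_i c i ^+ d i) * f.@[x].
  by apply: mulf_neq0; apply/prodf_neq0 => i _; apply: expf_neq0.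
rewrite !mevalE mulr_sumr big_seq [RHS]big_seq; apply: eq_bigr => m /fd md.
rewrite mulrCA; congr (_ * _).
have pairE (F : 'I_(n * N.+1) -> k) : \prod_l F l = \prod_i \prod_j F (mxvec_index i j).
  rewrite (reindex _ (curry_mxvec_bij _ _)) /= pair_bigA.
  by apply: eq_bigr => -[].
rewrite !pairE -big_split; apply: eq_bigr => i _ /=.
rewrite -(md i) -prodrXr -big_split; apply: eq_bigr => j _ /=.
by rewrite yx exprMn.
Qed.

(** This is irreducibility of the product of projective spaces: each open set contains the
    nonvanishing locus of a nonzero multihomogeneous polynomial, and the product of two such
    polynomials is nonzero somewhere. *)
Lemma open_dense (U : set (chow0 k N n)) : zariski_open U -> U !=set0 -> zariski_dense U.
Proof.
have ex W : zariski_open W -> W !=set0 -> exists S : set {mpoly k[n * N.+1]},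
    (forall f, S f -> multihomogeneous f) /\
    (exists2 f, S f & f != 0) /\
    forall s, (exists2 f, S f & f.@[multi_coords s] != 0) -> W (cycle_of s).
  move=> [S [mS ES]] [c Wc]; exists S; split=> //; split.
    have : (@cycle_of k N n @^-1` W) (repr c) by rewrite /= /cycle_of reprK.
    rewrite -[_ @^-1` _]setCK ES => /existsNP[f /not_implyP[Sf /eqP nz]].
    by exists f => //; apply: contraNneq nz => ->; rewrite meval0.
  move=> s [f Sf nz]; have : (~` ~` (@cycle_of k N n @^-1` W)) s.
    by rewrite ES => /(_ f Sf) /eqP; rewrite (negPf nz).
  by rewrite setCK.
move=> oU U0 V oV V0.
have [S [mS [[f Sf f0] hU]]] := ex U oU U0.
have [T [mT [[g Tg g0] hV]]] := ex V oV V0.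
(* The extra factors, one coordinate per point, force each block of x to be a nonzero row. *)
have : f * g * \prod_(i < n) 'X_(mxvec_index i (ord0 : 'I_N.+1)) != 0.
  rewrite !mulf_neq0 //; apply/prodf_neq0 => i _.
  by rewrite -msize_poly_eq0 msizeX.
case/(mpoly_nonroot char0) => x; rewrite !rmorphM rmorph_prod !mulf_eq0 !negb_or.
case/andP => /andP[fx gx] /prodf_neq0 xi.
have [i|s [c sc]] := @tuple_of_rows (fun i => \row_j x (mxvec_index i j)).
  apply/eqP => /rowP/(_ ord0); rewrite !mxE => E.
  by have := xi i isT; rewrite /= mevalXU E eqxx.
have sx i j : multi_coords s (mxvec_index i j) = c i * x (mxvec_index i j).
  by rewrite multi_coordsE (sc i).2 mxE.
have c0 i := (sc i).1.
exists (cycle_of s); split; [apply: hU; exists f | apply: hV; exists g] => //.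
  by apply: (multihomogeneous_scale (mS _ Sf) c0 sx).
by apply: (multihomogeneous_scale (mT _ Tg) c0 sx).
Qed.

End Density.

(** * Symbolic powers of ideals of points *)

Section Ideals.
Local Open Scope quotient_scope.
Local Open Scope classical_set_scope.
Local Open Scope ring_scope.
Variable R : idomainType.
Implicit Types (I J P : set R) (m : nat).

Lemma ideal_spanP (S J : set R) : is_ideal J -> (forall f, S f -> J f) ->
  forall f, ideal_span S f -> J f.
Proof.
move=> [J0 JD JM] SJ _ [r [c [g [Sg ->]]]].
by apply: (big_ind J) => // i _; apply/JM/SJ.
Qed.

Lemma mem_ideal_span (S : set R) f : S f -> ideal_span S f.
Proof.
by move=> Sf; exists 1%N, (fun=> 1), (fun=> f); rewrite big_ord1 mul1r.
Qed.

(** It supplies nonzero forms in the symbolic power, so that [initial_degree] does not fall back on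
    its default. *)
Lemma exp_symbolic I m f : I f -> symbolic_power I m (f ^+ m).
Proof.
move=> If P [[_ P1 _] _]; exists 1%N, (fun=> 1), (fun=> f ^+ m).
split=> [_|]; last by rewrite big_ord1 mul1r.
split; first by exists 1, 1; split=> //; rewrite tofrac1 divr1.
apply: mem_ideal_span; exists (fun=> f); split=> //.
by rewrite prodr_const card_ord.
Qed.

(** Multiply by the product of all denominators, which stays outside P by primality. *)
Lemma local_ext_clear P J f : is_prime_ideal P -> is_ideal J ->
  local_ext P J (tofrac f) -> exists2 s, ~ P s & J (s * f).
Proof.
move=> [[P0 _ _] P1 Pprime] [J0 JD JM] [r [u [a [hua E]]]].
have /fin_all_exists[b /fin_all_exists[s hs]] i :
    exists b s, ~ P s /\ u i = tofrac b / tofrac s by exact: (hua i).1.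
have s0 i : s i != 0 by apply: contra_notN (hs i).1 => /eqP ->.
exists (\prod_i s i).
  apply: (big_ind (fun x => ~ P x)) => // [x y Px Py /Pprime[]//|i _].
  exact: (hs i).1.
suff -> : (\prod_i s i) * f = \sum_i (\prod_(j | j != i) s j * b i) * a i.
  by apply: (big_ind J) => // i _; apply/JM/(hua i).2.
apply/eqP; rewrite -tofrac_eq tofracM E mulr_sumr rmorph_sum; apply/eqP.
apply: eq_bigr => i _; rewrite (bigD1 i) //= !tofracM (hs i).2.
have : tofrac (s i) != 0 by rewrite tofrac_eq0.
by move: (tofrac (s i)) (tofrac _) (tofrac _) (tofrac _) => x y z w x0; field.
Qed.

Lemma ideal_span_ideal (S : set R) : is_ideal (ideal_span S).
Proof.
split.
- by exists 0%N, (fun=> 0), (fun=> 0); split=> [[]|] //; rewrite big_ord0.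
- move=> _ _ [r [c [g [Sg ->]]]] [r' [c' [g' [Sg' ->]]]].
  exists (r + r')%N, (fun i => match split i with inl a => c a | inr a => c' a end),
    (fun i => match split i with inl a => g a | inr a => g' a end).
  split=> [i|]; first by case: (split i).
  rewrite big_split_ord /=; congr (_ + _); apply: eq_bigr => i _.
    by rewrite (unsplitK (inl i)).
  by rewrite (unsplitK (inr i)).
move=> c _ [r [c' [g [Sg ->]]]]; exists r, (fun i => c * c' i), g; split=> //.
by rewrite mulr_sumr; apply: eq_bigr => i _; rewrite mulrA.
Qed.

End Ideals.

Section Cone.
Variables (k : fieldType) (M : nat).
Implicit Types (p : 'I_M -> k) (f g : {mpoly k[M]}).

(* Restriction to the line through the origin and p; its kernel is the ideal of the
   projective point p. *)
Definition cone p f : {poly k} := mmap polyC (fun j => 'X * (p j)%:P) f.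

Lemma coneM p f g : cone p (f * g) = cone p f * cone p g.
Proof. exact: rmorphM. Qed.

Lemma cone_homog p e f : f \is e.-homog -> cone p f = (f.@[p])%:P * 'X^e.
Proof.
move=> fe; rewrite /cone (mmap_scale _ _ _ fe) mulrC; congr (_ * _).
by rewrite /meval rmorph_mmap.
Qed.

Lemma cone_horner p f c : (cone p f).[c] = f.@[fun j => c * p j].
Proof.
rewrite -horner_evalE /cone rmorph_mmap; apply: mmap_eqr => j /=.
  by rewrite horner_evalE hornerC.
by rewrite horner_evalE !hornerE.
Qed.

(** The coefficient of X^d in [cone p f] is the value at p of the component of degree d. *)
Lemma cone_pihomog p f : cone p f = 0 -> forall d, (pihomog mdeg d f).@[p] = 0.
Proof.
move=> f0 d; have [df|fd] := ltnP d (msize f); last first.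
  suff -> : pihomog mdeg d f = 0 by rewrite meval0.
  rewrite pihomogE big1_seq // => m /andP[/eqP md /msize_mdeg_lt].
  by rewrite md ltnNge fd.
have := congr1 (fun q : {poly k} => q`_d) f0.
rewrite {1}(dhomog_sum_pihomog f) /cone raddf_sum coef_sum coef0 /=.
rewrite (bigD1 (Ordinal df)) //= big1 ?addr0 => [|i /negPf di].
  by rewrite -/(cone _ _) (cone_homog _ (pihomogP _ _ _)) coefMXn ltnn subnn coefC.
rewrite -/(cone _ _) (cone_homog _ (pihomogP _ _ _)) coefCM coefXn.
by rewrite -val_eqE /= eq_sym in di; rewrite di mulr0.
Qed.

End Cone.

Section PointIdeals.
Local Open Scope quotient_scope.
Local Open Scope classical_set_scope.
Local Open Scope ring_scope.
Variables (k : fieldType) (char0 : [pchar k] =i pred0) (N n : nat).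
Local Notation PN := (proj_space k N).
Variables (s : n.-tuple PN) (us : uniq s).
Local Notation I := (vanishing_ideal [set` s]).

Definition point_ideal i : set {mpoly k[N.+1]} := [set g | cone (hcoords s i) g = 0].

Lemma point_ideal_prime i : is_prime_ideal (point_ideal i).
Proof.
split; [split=> [|f g f0 g0|c f f0] | |] => /=.
- exact: raddf0.
- by rewrite /point_ideal /cone /= raddfD /= [X in X + _]f0 [X in _ + X]g0 addr0.
- by rewrite /point_ideal /= coneM f0 mulr0.
- by rewrite /point_ideal /= /cone rmorph1 => /eqP; rewrite oner_eq0.
by move=> f g; rewrite /point_ideal /= coneM => /eqP; rewrite mulf_eq0 => /orP[]/eqP; [left|right].
Qed.

Lemma vanishing_sub_point_ideal i f : I f -> point_ideal i f.
Proof.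
have [Pid _ _] := point_ideal_prime i; apply: (ideal_spanP Pid) => g [[d gd] g0].
rewrite /point_ideal /= (cone_homog _ gd) (_ : g.@[_] = 0) ?mul0r //.
by apply: g0; rewrite /= mem_tnth.
Qed.

(** A product over j != i of linear forms through p_j that avoid p_i; such forms exist because the
    points are distinct. *)
Lemma separating_form i : exists f : {mpoly k[N.+1]}, exists e,
  [/\ f \is e.-homog, f.@[hcoords s i] != 0 & forall j, j != i -> f.@[hcoords s j] = 0].
Proof.
have /fin_all_exists[l hl] j : exists l : {mpoly k[N.+1]},
    [/\ l \is 1.-homog, (j != i -> l.@[hcoords s i] != 0) & l.@[hcoords s j] = 0].
  have [->|ji] := eqVneq j i; first by exists 0; rewrite rpred0 meval0.
  have : ~~ (coords (tnth s i) <= coords (tnth s j))%MS.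
    by apply: contraNN ji => /coords_inj/(tuple_uniqP _ us) ->.
  (* A column of the cokernel of p_j is a linear form zero at p_j; some column is nonzero at p_i,
     which is off the line of p_j. *)
  rewrite submxE => /matrix0Pn[z [c hc]].
  have lE a : (\sum_b cokermx (coords (tnth s j)) b c *: 'X_b).@[hcoords s a] =
      (coords (tnth s a) *m cokermx (coords (tnth s j))) 0 c.
    rewrite raddf_sum mxE; apply: eq_bigr => b _.
    by rewrite /= mevalZ mevalXU mulrC.
  exists (\sum_b cokermx (coords (tnth s j)) b c *: 'X_b); split.
  - by apply: rpred_sum => b _; apply: rpredZ; rewrite dhomogX /= mdeg1.
  - by rewrite lE -[0 in X in X != _](ord1 z).
  by rewrite lE mulmx_coker mxE.
exists (\prod_(j | j != i) l j), (\sum_(j | j != i) 1)%N; split.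
- elim/big_rec2: _ => [|j d q _ hq]; first exact: dhomog1.
  by apply: dhomogM => //; case: (hl j).
- by rewrite rmorph_prod; apply/prodf_neq0 => j ji; case: (hl j) => _ /(_ ji).
move=> j ji; rewrite rmorph_prod (bigD1 j) //= (_ : (l j).@[_] = 0) ?mul0r //.
by case: (hl j).
Qed.

(** The ideal of p_i annihilates the class of a form that vanishes at exactly the other points.
    Hence p_i is among the primes over which the symbolic power is intersected. *)
Lemma point_ideal_associated i : associated_prime I (point_ideal i).
Proof.
split; first exact: point_ideal_prime.
have [f [e [fe fi fj]]] := separating_form i.
exists f; apply/seteqP; split=> g /= h.
  exists (msize g), (fun=> 1), (fun d => pihomog mdeg d g * f); split=> [d|].
    split; first by exists (d + e)%N; apply: dhomogM => //; apply: pihomogP.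
    move=> p /= /tnthP[j ->]; rewrite mevalM -/(hcoords s j).
    have [->|ji] := eqVneq j i; first by rewrite cone_pihomog // mul0r.
    by rewrite fj ?mulr0.
  by rewrite {1}(dhomog_sum_pihomog g) mulr_suml; apply: eq_bigr => d _; rewrite mul1r.
have /= := vanishing_sub_point_ideal i h; rewrite /point_ideal /= coneM => /eqP.
rewrite mulf_eq0 => /orP[/eqP//|]; rewrite (cone_homog _ fe) mulf_eq0 polyC_eq0.
by rewrite (negPf fi) /= expf_eq0 polyX_eq0 andbF.
Qed.

(** All multiples c p are covered because a denominator outside the ideal of the point may be
    inhomogeneous and vanish at the chosen coordinates. *)
Lemma ideal_exp_vanishes m i f c :
  ideal_exp I m f -> vanishes m f (fun j => c * hcoords s i j).
Proof.
apply: (@ideal_spanP _ _ [set f | vanishes m f (fun j => c * hcoords s i j)]).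
  split=> [v|g h gv hv|g h hv] /=; first by rewrite /expand raddf0 dvdp0.
    exact: vanishesD.
  exact: vanishes_mull.
move=> _ [g [Ig ->]] /=.
suff : vanishes (\sum_(j < m) 1) (\prod_j g j) (fun j => c * hcoords s i j).
  by rewrite sum1_card card_ord.
elim/big_rec2: _ => [|j d q _ hq]; first exact: vanishes0.
apply: vanishesM => //; apply: vanishes1; rewrite -cone_horner.
by have /= := vanishing_sub_point_ideal i (Ig j); rewrite /point_ideal /= => ->; rewrite horner0.
Qed.

(** After clearing denominators, a f lies in I^m with a nonzero on the line of p. At a multiple of p
    where a is nonzero, a cancels; homogeneity of f leads back to p. *)
Lemma symbolic_power_vanishes m i e f : f \is e.-homog ->
  symbolic_power I m f -> vanishes m f (hcoords s i).
Proof.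
move=> fe /(_ _ (point_ideal_associated i)) /= h.
have [a] := local_ext_clear (point_ideal_prime i) (ideal_span_ideal _) h.
rewrite /point_ideal /= => /eqP a0 Iaf.
(* The factor X ensures c != 0. *)
have /(poly_nonroot char0)[c] : 'X * cone (hcoords s i) a != 0.
  by rewrite mulf_neq0 ?polyX_eq0.
rewrite hornerM hornerX mulf_eq0 negb_or cone_horner => /andP[c0 ac].
apply: (vanishes_scale fe c0); apply: vanishes_unit ac _.
exact: ideal_exp_vanishes.
Qed.

(** The points impose n linear conditions on a space of dimension greater than n. *)
Lemma vanishing_form d : (n < 'C(d + N, N))%N ->
  exists f, [/\ f != 0, f \is d.-homog & I f].
Proof.
move=> nlt; pose A := \matrix_(b < 'C(d + N, d), i < n) (@hform_basis k N d b).@[hcoords s i].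
have : kermx A != 0.
  rewrite -mxrank_eq0 mxrank_ker subn_eq0 -ltnNge (leq_ltn_trans (rank_leq_col _)) //.
  by rewrite -bin_sub ?leq_addr // addKn.
case/rowV0Pn => u /sub_kermxP uA u0.
exists (@hform k N d u); split; [by rewrite hform_eq0 | exact: hform_homog |].
apply: mem_ideal_span; split; first by exists d; apply: hform_homog.
move=> p /= /tnthP[i ->]; have := congr1 (fun B : 'rV_n => B 0 i) uA.
rewrite [RHS]mxE mxE -/(hcoords s i); under eq_bigr do rewrite mxE.
by move=> E; rewrite meval_hform.
Qed.

End PointIdeals.

(** * Initial degrees *)

Section InitialDegree.
Local Open Scope classical_set_scope.
Variables (k : fieldType) (r : nat) (I : set {mpoly k[r]}).

Lemma initial_degree_le d f : f != 0 -> f \is d.-homog -> I f -> (initial_degree I <= d)%N.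
Proof.
move=> f0 fd If; rewrite /initial_degree.
by case: xgetP => [x _ [_ h]|_]; [apply: h fd If | apply: leq0n].
Qed.

Lemma initial_degree_attained d f : f != 0 -> f \is d.-homog -> I f ->
  exists f, [/\ f != 0, f \is (initial_degree I).-homog & I f].
Proof.
move=> f0 fd If; pose P e := `[< exists f, [/\ f != 0, f \is e.-homog & I f] >].
have exP : exists e, P e by exists d; apply/asboolP; exists f.
case: (ex_minnP exP) => e /asboolP Pe mine.
suff /(xgetI 0%N)[] : [set d | (exists f : {mpoly k[r]}, [/\ f != 0, f \is d.-homog & I f]) /\
    (forall e (f : {mpoly k[r]}), f != 0 -> f \is e.-homog -> I f -> (d <= e)%N)] e by [].
by split=> // e' g g0 ge' Ig; apply/mine/asboolP; exists g.
Qed.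

End InitialDegree.

Lemma ltn_binomial N n : (0 < N)%N -> (n < 'C(n + N, N))%N.
Proof.
case: N => // N _; elim: N => [|N ih]; first by rewrite bin1 addn1.
by rewrite addnS binS; apply: leq_trans ih (leq_addl _ _).
Qed.

(** * Star configurations as tuples of projective points *)

Section StarConfiguration.
Variables (k : fieldType) (char0 : [pchar k] =i pred0) (N r n : nat).

Lemma rootpoly_row_neq0 (S : seq k) : (size S <= N)%N ->
  \row_(j < N.+1) (rootpoly S)`_j != 0.
Proof.
move=> sS; apply/eqP => /rowP/(_ (inord (size S))); rewrite !mxE inordK ?ltnS //.
have := monicP (monic_prod_XsubC S xpredT id).
rewrite lead_coefE size_prod_XsubC /= => -> /eqP; by rewrite oner_eq0.
Qed.

Lemma star_configuration : (N <= r)%N -> ('C(r, N) <= n)%N ->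
  exists s : n.-tuple (proj_space k N), forall m e (f : {mpoly k[N.+1]}),
    f != 0 -> f \is e.-homog -> (forall i, vanishes m f (hcoords s i)) ->
    (r * m <= N * e)%N.
Proof.
move=> Nr rn; pose T : seq k := [seq i%:R | i <- iota 0 r].
have uT : uniq T by rewrite map_inj_uniq ?iota_uniq //; apply: natr_inj.
have sT : size T = r by rewrite size_map size_iota.
pose roots (A : {set 'I_r}) : seq k := [seq (val a)%:R | a <- enum A].
pose D := enum [set A : {set 'I_r} | #|A| == N].
(* Positions beyond the C(r, N) star points get the empty set, whose root polynomial 1 is still a
   valid point. *)
pose B (i : 'I_n) := nth finset.set0 D i.
have [i|s [c sc]] := @tuple_of_rows k N n (fun i => \row_j (rootpoly (roots (B i)))`_j).
  apply: rootpoly_row_neq0; rewrite size_map -cardE /B.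
  have [iD|iD] := ltnP i (size D); last by rewrite nth_default // cards0.
  by have := mem_nth finset.set0 iD; rewrite mem_enum inE => /eqP ->.
exists s => m e f f0 fe fv.
rewrite -sT in Nr *; suff /(star_bound char0 uT Nr f0 fe)[] : forall S, uniq S -> size S = N ->
    {subset S <= T} -> vanishes m f (fun i => (rootpoly S)`_i) by [].
move=> S uS sS ST.
pose A : {set 'I_r} := [set a : 'I_r | (val a)%:R \in S].
have pS : perm_eq (roots A) S.
  apply: uniq_perm => // [|x].
    rewrite map_inj_uniq ?enum_uniq // => a b /(natr_inj char0).
    exact: val_inj.
  apply/mapP/idP => [[a]|xS]; first by rewrite mem_enum inE => ? ->.
  have /mapP[i] := ST x xS; rewrite mem_iota /= add0n => ir xi.
  by exists (Ordinal ir) => //; rewrite mem_enum inE /= -xi.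
have cA : #|A| = N by rewrite cardE -(size_map (fun a => (val a)%:R : k)) (perm_size pS).
have AD : A \in D by rewrite mem_enum inE cA.
have iD : (index A D < n)%N.
  have := card_draws 'I_r N; rewrite card_ord cardE => E.
  by apply: leq_trans rn; rewrite -E index_mem.
have := fv (Ordinal iD); have [c0 E] := sc (Ordinal iD).
have -> : hcoords s (Ordinal iD) = fun j => c (Ordinal iD) * (rootpoly S)`_j.
  apply: funext => j; rewrite E mxE /B /= nth_index //.
  by rewrite /rootpoly (perm_big _ pS).
exact: vanishes_scale fe c0.
Qed.

End StarConfiguration.

(** * The bound for very general points *)

Lemma no_multiple_form_cycle (k : fieldType) (N n e m : nat) (s : n.-tuple (proj_space k N)) :
  ~ has_multiple_form e m s -> no_multiple_form e m (cycle_of s).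
Proof.
by move=> nb s' /eqmodP /= ss' b; apply: nb; apply: has_multiple_form_perm b.
Qed.

(** Multiplying by a power of x_0 reaches degree e exactly, so excluding the single degree e
    excludes all smaller ones. *)
Lemma has_multiple_form_raise (k : fieldType) (N n e m : nat) (s : n.-tuple (proj_space k N)) d f :
  (d <= e)%N -> f != 0 -> f \is d.-homog -> (forall i, vanishes m f (hcoords s i)) ->
  has_multiple_form e m s.
Proof.
move=> de f0 fd fv; exists ('X_ord0 ^+ (e - d) * f); split.
- by rewrite mulf_neq0 // expf_neq0 // -msize_poly_eq0 msizeX.
- rewrite -(subnK de) addnK; apply: dhomogM => //.
  have X1 : ('X_ord0 : {mpoly k[N.+1]}) \is 1.-homog by rewrite dhomogX /= mdeg1.
  by have := dhomogMn (e - d) X1; rewrite mul1n.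
by move=> i; apply: vanishes_mull.
Qed.

Theorem theorem2p8 (k : closedFieldType) (hk : [pchar k] =i pred0)
    (N n : nat) (hN : (1 <= N)%N) (hn : (1 <= n)%N) :
  @for_very_general_points k N n (fun X =>
    forall m : nat, (1 <= m)%N ->
      (initial_degree (symbolic_power (vanishing_ideal X) m))%:R / m%:R >=
      ((initial_degree (vanishing_ideal X))%:R + N%:R - 1) / N%:R :> rat).
Proof.
have ex : exists d, (n < 'C(d + N, N))%N by exists n; apply: ltn_binomial.
case: (ex_minnP ex) => d nd mind.
have d0 : (0 < d)%N by case: d nd {mind} => //; rewrite add0n binn ltnNge hn.
pose r := (d.-1 + N)%N.
(* By minimality of d, the degree d - 1 fails the inequality n < C(d - 1 + N, N). *)
have rn : ('C(r, N) <= n)%N.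
  by rewrite leqNgt; apply/negP => /mind; rewrite -ltnS prednK // ltnn.
have [star starP] := star_configuration hk (leq_addl d.-1 N) rn.
(* e m is the largest degree forbidden by the bound, see eP. *)
pose e m := ((r * m).-1 %/ N)%N.
have eP m a : (0 < m)%N -> (a <= e m)%N = (N * a < r * m)%N.
  move=> m0; rewrite leq_divRL // mulnC -ltnS prednK // muln_gt0 m0.
  by rewrite /r addn_gt0 hN orbT.
(* One star configuration lies in all the open sets, which makes each of them dense and their
   intersection nonempty. *)
have starU i : no_multiple_form (e i.+1) i.+1 (cycle_of star).
  apply: no_multiple_form_cycle => -[f [f0 fe fv]].
  by have := starP _ _ f f0 fe fv; rewrite leqNgt -eP ?leqnn.
exists (fun i => no_multiple_form (e i.+1) i.+1); split.
- move=> i; have oU := @no_multiple_form_open k N n (e i.+1) i.+1; split=> //.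
  by apply: (open_dense hk) => //; exists (cycle_of star).
- by exists (cycle_of star) => i _; apply: starU.
move=> s us sU m m0; set I := vanishing_ideal _.
have [g [g0 gd Ig]] := vanishing_form s nd.
have le_d : (initial_degree I <= d)%N := initial_degree_le g0 gd Ig.
have [f [f0 fa If]] := initial_degree_attained (expf_neq0 m g0) (dhomogMn m gd) (exp_symbolic m Ig).
set a := initial_degree (symbolic_power I m) in fa *.
have key : (r * m <= N * a)%N.
  rewrite leqNgt -eP //; apply/negP => ae.
  (* The open set of index i concerns multiplicity i + 1. *)
  have := sU m.-1 Logic.I; rewrite /= prednK // => /(_ s erefl); apply.
  apply: (has_multiple_form_raise ae f0 fa) => i.
  exact: (symbolic_power_vanishes hk us i fa If).
have m0' : (0 < m%:R :> rat) by rewrite Num.Theory.ltr0n.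
have N0' : (0 < N%:R :> rat) by rewrite Num.Theory.ltr0n.
rewrite Num.Theory.ler_pdivrMr // mulrAC Num.Theory.ler_pdivlMr //.
have -> : (initial_degree I)%:R + N%:R - 1 = (initial_degree I + N.-1)%:R :> rat.
  by rewrite natrD -addrA -subn1 natrB.
rewrite -!natrM Num.Theory.ler_nat (leq_trans _ (leq_trans key _)) //; last by rewrite mulnC.
(* From alpha(I) <= d follows alpha(I) + N - 1 <= d - 1 + N = r. *)
by rewrite leq_mul2r /r; move: (initial_degree I) le_d => b bd; apply/orP; right; lia.
Qed.
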